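(* Let $p\geq 2$ be an integer. If $G$ is a finite simple graph which is both $(P_3\cup P_2)$-free and $((K_1\cup K_2)+K_p)$-free, then $\chi(G)\leq \omega(G)+\sum_{j=2}^{p+1}(j-1)(p-j+3)$ if $3\leq\omega(G)\leq p+1$; $\chi(G)\leq \omega(G)+7(p-1)+\sum_{j=4}^{p-\lfloor k/2\rfloor}(j-1)(p-j+3)$ if $\omega(G)=p+2+k$ with $0\leq k\leq 2p-5$; $\chi(G)\leq \omega(G)+4p-3$ if $\omega(G)=3p-2$; $\chi(G)\leq \omega(G)+p-1$ if $\omega(G)\geq 3p-1$.
   Context: All graphs are finite, simple, undirected. $\omega$ is the clique number and $\chi$ the chromatic number. $P_n$ is the path on $n$ vertices, $K_n$ the complete graph; $G_1\cup G_2$ is disjoint union and $G_1+G_2$ is the join (disjoint union plus all edges between them). A graph is $H$-free if it has no induced subgraph isomorphic to $H$. An empty sum is $0$. *)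

(* Defs.v *)
From HB Require Import structures.
From mathcomp Require Import all_boot.

Set Implicit Arguments.
Unset Strict Implicit.
Unset Printing Implicit Defensive.

Record sgraph := SGraph {
  vertex :> finType;
  adj : rel vertex;
  adj_sym : symmetric adj;
  adj_irrefl : irreflexive adj }.

Definition is_clique (G : sgraph) (A : {set G}) : bool :=
  [forall x in A, forall y in A, (x != y) ==> adj x y].

Definition clique_number (G : sgraph) : nat :=
  \max_(A : {set G} | is_clique A) #|A|.

Definition colorable (G : sgraph) (k : nat) : bool :=
  [exists f : {ffun G -> 'I_k}, forall x, forall y, adj x y ==> (f x != f y)].

Lemma colorable_card (G : sgraph) : exists k, colorable G k.
Proof.
exists #|G|; apply/existsP; exists [ffun x => enum_rank x].
apply/forallP => x; apply/forallP => y; apply/implyP => xy.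
rewrite !ffunE (inj_eq enum_rank_inj); apply/eqP => exy.
by rewrite exy adj_irrefl in xy.
Qed.

Definition chromatic_number (G : sgraph) : nat := ex_minn (colorable_card G).

Definition isomorphic (G H : sgraph) : Prop :=
  exists f : G -> H, bijective f /\ forall x y, adj (f x) (f y) = adj x y.

Section Induced.
Variables (G : sgraph) (S : {set G}).
Definition induced_adj : rel {x : G | x \in S} :=
  fun x y => adj (val x) (val y).
Lemma induced_sym : symmetric induced_adj.
Proof. by move=> x y; apply: adj_sym. Qed.
Lemma induced_irrefl : irreflexive induced_adj.
Proof. by move=> x; apply: adj_irrefl. Qed.
Definition induced : sgraph := SGraph induced_sym induced_irrefl.
End Induced.

Definition is_free (H G : sgraph) : Prop :=
  forall S : {set G}, ~ isomorphic (induced S) H.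

Section Complete.
Variable n : nat.
Definition complete_adj : rel 'I_n := fun i j => i != j.
Lemma complete_sym : symmetric complete_adj.
Proof. by move=> i j; rewrite /complete_adj eq_sym. Qed.
Lemma complete_irrefl : irreflexive complete_adj.
Proof. by move=> i; rewrite /complete_adj eqxx. Qed.
Definition complete_graph : sgraph := SGraph complete_sym complete_irrefl.
End Complete.

Section Path.
Variable n : nat.
Definition path_adj : rel 'I_n :=
  fun i j => (i.+1 == j :> nat) || (j.+1 == i :> nat).
Lemma path_sym : symmetric path_adj.
Proof. by move=> i j; rewrite /path_adj orbC. Qed.
Lemma path_irrefl : irreflexive path_adj.
Proof. by move=> i; rewrite /path_adj orbb gtn_eqF. Qed.
Definition path_graph : sgraph := SGraph path_sym path_irrefl.
End Path.

Section Sums.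
Variables G H : sgraph.

(* [b] says whether vertices on different sides are adjacent. *)
Definition sum_adj (b : bool) : rel (G + H) := fun u v =>
  match u, v with
  | inl x, inl y => adj x y
  | inr x, inr y => adj x y
  | _, _ => b
  end.
Lemma sum_sym b : symmetric (sum_adj b).
Proof. by move=> [x|x] [y|y] //=; apply: adj_sym. Qed.
Lemma sum_irrefl b : irreflexive (sum_adj b).
Proof. by move=> [x|x] /=; apply: adj_irrefl. Qed.

Definition disjoint_union : sgraph :=
  SGraph (@sum_sym false) (@sum_irrefl false).
Definition join : sgraph := SGraph (@sum_sym true) (@sum_irrefl true).
End Sums.

(* Main.v *)
Require Import Defs.
From mathcomp Require Import all_boot zify.

Set Implicit Arguments.
Unset Strict Implicit.
Unset Printing Implicit Defensive.

(** Let A be a maximum clique with w vertices. A vertex is near a clique K if it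
    misses at most one vertex of K. When K is a maximal clique with at least
    p + 2 vertices, excluding (K1 u K2) + Kp makes the vertices near K induce a
    complete multipartite graph, and each vertex far from K sees at most p - 1
    of its parts. So the near vertices together with any P3-free set of far
    vertices are coloured greedily with w + p - 1 colours.

    The vertices far from A are sorted by the first two vertices of A that they
    miss, of indices i < j; each of these cells is P3-free, since the two missed
    vertices form an edge. The cells with large j form together a P3-free set,
    because three vertices of such cells have few neighbours in A; they are
    coloured with A at cost w + p - 1. For the remaining j, either all cells
    with this j have only cliques of order at most p - j + 3, and cost
    (j - 1)(p - j + 3) fresh colours, or one of them yields a clique K of order
    at least p + 2 to which all the other cells with this j are near, and all
    together cost w + p - 1, which is at most (j - 1)(p - j + 3) when j >= 5.
    If the cell of (1, 2) is the large one, the cells with j = 3 are also near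
    K, which keeps the cost of j <= 4 within the bound. *)

(** * Colourings and cliques *)

Section Colouring.
Variable G : sgraph.
Implicit Types (x y z : G) (S B K Q W : {set G}).

Definition nbhd x : {set G} := [set y | adj x y].

(** Colours are natural numbers given to every vertex but constrained on [S] only, so that two
    colourings combine by shifting one palette. *)
Definition col S k := exists f : G -> nat,
  (forall x, x \in S -> f x < k) /\
  (forall x y, x \in S -> y \in S -> adj x y -> f x != f y).

Lemma adjC x y : adj x y = adj y x. Proof. exact: adj_sym. Qed.

Lemma adjxx x : adj x x = false. Proof. exact: adj_irrefl. Qed.

Lemma is_cliqueP K :
  reflect (forall x y, x \in K -> y \in K -> x != y -> adj x y) (is_clique K).
Proof.
apply: (iffP forall_inP) => [h x y xK yK|h x xK].
  by have /forall_inP/(_ y yK)/implyP := h x xK.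
by apply/forall_inP => y yK; apply/implyP; apply: h.
Qed.

Lemma clique_leq K : is_clique K -> #|K| <= clique_number G.
Proof. by move=> cK; rewrite /clique_number (bigmax_sup K). Qed.

Lemma clique0 : @is_clique G set0.
Proof. by apply/is_cliqueP => x y; rewrite inE. Qed.

Lemma max_clique_exists : exists2 K : {set G}, is_clique K & #|K| = clique_number G.
Proof.
have [|K cK wK] := eq_bigmax_cond (fun K => #|K|) (A := [pred K : {set G} | is_clique K]).
  by apply/card_gt0P; exists set0; exact: clique0.
by exists K => //; exact: esym wK.
Qed.

Lemma cliqueS K Q : Q \subset K -> is_clique K -> is_clique Q.
Proof.
move=> /subsetP QK /is_cliqueP cK; apply/is_cliqueP => x y xQ yQ.
by apply: cK; apply: QK.
Qed.

Lemma cliqueU K Q : is_clique K -> is_clique Q ->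
  (forall x y, x \in K -> y \in Q -> adj x y) -> is_clique (K :|: Q).
Proof.
move=> /is_cliqueP cK /is_cliqueP cQ cKQ; apply/is_cliqueP => x y.
rewrite !inE => /orP[xK|xQ] /orP[yK|yQ] xy; [exact: cK|exact: cKQ| |exact: cQ].
by rewrite adjC; apply: cKQ.
Qed.

Lemma clique2 x y : adj x y -> is_clique [set x; y].
Proof.
move=> xy; apply/is_cliqueP => a b; rewrite !inE.
by move=> /orP[] /eqP-> /orP[] /eqP->; rewrite ?eqxx // adjC.
Qed.

Lemma chromatic_le k : col setT k -> chromatic_number G <= k.
Proof.
move=> [f [fk fP]]; rewrite /chromatic_number; case: ex_minnP => n _; apply.
apply/existsP; exists [ffun x => Ordinal (fk x (in_setT x))].
apply/forallP => x; apply/forallP => y; apply/implyP => xy.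
by rewrite !ffunE -val_eqE /=; apply: fP; rewrite ?inE.
Qed.

Lemma colS S B k : S \subset B -> col B k -> col S k.
Proof.
move=> /subsetP SB [f [fk fP]]; exists f; split=> [x /SB|x y /SB xB /SB yB].
  exact: fk.
exact: fP.
Qed.

Lemma colW S k l : k <= l -> col S k -> col S l.
Proof.
move=> kl [f [fk fP]]; exists f; split=> // x xS.
exact: leq_trans (fk x xS) kl.
Qed.

Lemma colU S B k l : col S k -> col B l -> col (S :|: B) (k + l).
Proof.
move=> [f [fk fP]] [g [gk gP]].
exists (fun x => if x \in S then f x else k + g x); split=> [x|x y].
  rewrite inE; case: ifPn => [xS _|xS /= xB].
    exact: leq_trans (fk _ xS) (leq_addr _ _).
  by rewrite ltn_add2l gk.
rewrite !inE; case: ifPn => [xS _|xS /= xB]; case: ifPn => [yS _|yS /= yB] xy.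
- exact: fP.
- by rewrite neq_ltn (leq_trans (fk _ xS)) ?leq_addr.
- by rewrite neq_ltn (leq_trans (fk _ yS)) ?leq_addr // orbT.
- by rewrite eqn_add2l; apply: gP.
Qed.

Lemma col0 : col set0 0.
Proof. by exists (fun=> 0); split=> [x|x y]; rewrite inE. Qed.

Lemma col_fibres (J : G -> nat) S a b (c : nat -> nat) :
  (forall j, a <= j < b -> col [set x in S | J x == j] (c j)) ->
  col [set x in S | a <= J x < b] (\sum_(a <= j < b) c j).
Proof.
elim: b => [|b IH] h.
  rewrite big_geq //; apply: colS col0.
  by apply/subsetP => x; rewrite !inE ltn0 !andbF.
have [ab|ba] := leqP a b; last first.
  rewrite big_geq //; apply: colS col0; apply/subsetP => x.
  by rewrite !inE => /and3P[_ aJ Jb]; have := leq_ltn_trans aJ Jb; rewrite ltnS leqNgt ba.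
rewrite big_nat_recr //=.
apply: colS (colU (IH _) (h b _)); last by rewrite ab /=.
  apply/subsetP => x; rewrite !inE => /and3P[-> /= -> /=].
  by rewrite ltnS leq_eqVlt orbC.
by move=> j /andP[aj jb]; apply: h; rewrite aj ltnW.
Qed.

Lemma fresh_colour (s : seq nat) n : size s < n -> exists2 c, c < n & c \notin s.
Proof.
move=> sn; have [/allP h|/allPn[c]] := boolP (all (mem s) (iota 0 n)).
  by have := uniq_leq_size (iota_uniq 0 n) h; rewrite size_iota leqNgt sn.
by rewrite mem_iota /= => cn cs; exists c.
Qed.

(** [F x] lists the colours that [x] may meet on [B]; many neighbours can share one colour, so its
    size may be far below the degree of [x] into [B]. The vertices of [S] are added one at a
    time. *)
Lemma greedy_extension n B S f (F : G -> seq nat) :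
  (forall x, x \in B -> f x < n) ->
  (forall x y, x \in B -> y \in B -> adj x y -> f x != f y) ->
  (forall x, x \in S -> x \notin B) ->
  (forall x y, x \in S -> y \in B -> adj x y -> f y \in F x) ->
  (forall x, x \in S -> size (F x) + #|S :&: nbhd x| < n) ->
  col (B :|: S) n.
Proof.
move=> fn fP SB fF Sn.
(* Agreement with [f] off [S] keeps the lists [F] valid throughout the induction. *)
suff [g [_ gn gP]] : exists g : G -> nat,
    [/\ (forall x, x \notin S -> g x = f x),
        (forall x, x \in B :|: S -> g x < n) &
        forall x y, x \in B :|: S -> y \in B :|: S -> adj x y -> g x != g y].
  by exists g.
have [N] := ubnP #|S|; elim: N S SB fF Sn => // N IH S SB fF Sn SN.
have [->|[x xS]] := set_0Vmem S.
  exists f; split=> [//|x|x y]; rewrite setU0; [exact: fn|exact: fP].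
have sub u : u \in S :\ x -> u \in S by rewrite !inE => /andP[].
have [||||g [gf gn gP]] := IH (S :\ x).
- by move=> u /sub; apply: SB.
- by move=> u v /sub; apply: fF.
- move=> u /sub uS; apply: leq_ltn_trans (Sn u uS).
  by rewrite leq_add2l subset_leq_card // setSI // subD1set.
- by move: SN; rewrite (cardsD1 x) xS; lia.
have [|c cn] := @fresh_colour (F x ++ map g (enum (S :&: nbhd x))) n.
  by rewrite size_cat size_map -cardE Sn.
rewrite mem_cat negb_or => /andP[cF cg].
have new y : y \in B :|: S -> adj x y -> c != g y.
  rewrite inE => /orP[yB|yS] xy; apply/eqP => cy.
    have yS : y \notin S by apply: contraL yB; apply: SB.
    by move/negP: cF; apply; rewrite cy gf ?fF // inE (negPf yS) andbF.
  by move/negP: cg; apply; rewrite cy map_f // mem_enum !inE yS.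
have old y : y != x -> y \in B :|: S -> y \in B :|: S :\ x.
  by move=> yx; rewrite !inE yx.
exists (fun y => if y == x then c else g y); split=> [y yS|y yBS|y z yBS zBS yz].
- have /negPf-> : y != x by apply: contraNneq yS => ->.
  by apply: gf; rewrite inE (negPf yS) andbF.
- by case: eqP => // /eqP yx; apply/gn/old.
- case: (eqVneq y x) yz => [->|yx]; case: (eqVneq z x) => [->|zx] yz.
  + by rewrite adjxx in yz.
  + exact: new.
  + by rewrite eq_sym; apply: new; rewrite // adjC.
  + by apply: gP => //; apply: old.
Qed.

(** Equivalently, [S] induces a P3-free graph, that is, a disjoint union of cliques. *)
Definition cluster S := forall x y z,
  x \in S -> y \in S -> z \in S -> adj x y -> adj y z -> x != z -> adj x z.

Lemma cluster_closed_nbhd S x : cluster S -> x \in S ->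
  is_clique (x |: S :&: nbhd x).
Proof.
move=> cS xS; apply/is_cliqueP => y z.
rewrite !inE => /orP[/eqP->|/andP[yS xy]] /orP[/eqP->|/andP[zS xz]] //.
- by rewrite eqxx.
- by rewrite adjC.
- by apply: (cS _ x); rewrite // adjC.
Qed.

Lemma cluster_degree S x n : cluster S -> x \in S ->
  (forall Q, Q \subset S -> is_clique Q -> #|Q| <= n) -> #|S :&: nbhd x| < n.
Proof.
move=> cS xS h.
have := h _ _ (cluster_closed_nbhd cS xS).
rewrite cardsU1 !inE adjxx andbF /= add1n; apply.
by rewrite subUset sub1set xS subsetIl.
Qed.

Lemma cluster_col S n : cluster S ->
  (forall Q, Q \subset S -> is_clique Q -> #|Q| <= n) -> col S n.
Proof.
move=> cS h; rewrite -(set0U S).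
apply: (@greedy_extension n set0 S (fun=> 0) (fun=> [::])) => //=.
- by move=> x; rewrite inE.
- by move=> x y; rewrite inE.
- by move=> x; rewrite inE.
- by move=> x y; rewrite inE.
- by move=> x xS; rewrite add0n; apply: cluster_degree.
Qed.

(** * Embeddings of the two forbidden graphs *)

Lemma not_free (H : sgraph) (f : H -> G) : injective f ->
  (forall u v, adj (f u) (f v) = adj u v) -> ~ is_free H G.
Proof.
move=> f_inj fP /(_ (f @: setT)); apply.
have fS u : f u \in f @: setT by rewrite imset_f.
(* Isomorphisms run from the induced graph to [H], so the one needed is the inverse of [f] onto its
   image. *)
pose h u : induced (f @: setT) := exist _ (f u) (fS u).
have h_inj : injective h by move=> u v [/f_inj].
have [g hK gK] : bijective h.
  apply: inj_card_bij => //.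
  rewrite /= card_sig (@eq_card _ _ (mem (f @: setT))) //.
  by rewrite -cardsT leq_imset_card.
exists g; split; first by exists h.
by move=> x y; rewrite -fP -{2}(gK x) -{2}(gK y).
Qed.


(** Otherwise [x] is the K1, the edge [y z] the K2, and any [p] vertices of [W] the Kp. *)
Lemma no_K1K2_Kp p x y z W :
  is_free (join (disjoint_union (complete_graph 1) (complete_graph 2))
                (complete_graph p)) G ->
  is_clique W -> adj y z -> ~~ adj x y -> ~~ adj x z ->
  (forall w, w \in W -> [/\ adj x w, adj y w & adj z w]) -> #|W| < p.
Proof.
move=> hK /is_cliqueP cW yz xy xz hW; rewrite ltnNge; apply/negP => pW.
pose u (k : 'I_p) : G := enum_val (widen_ord pW k).
have uW k : u k \in W by apply: enum_valP.
have u_inj : injective u.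
  by move=> k l /enum_val_inj /(congr1 val) /= /val_inj.
have uu k l : adj (u k) (u l) = (k != l).
  have [->|kl] := eqVneq k l; first by rewrite adjxx.
  by apply: cW; rewrite ?uW // (inj_eq u_inj).
pose f (v : join (disjoint_union (complete_graph 1) (complete_graph 2))
                 (complete_graph p)) : G :=
  match v with
  | inl (inl _) => x
  | inl (inr i) => if i == ord0 then y else z
  | inr k => u k
  end.
have I2 (i j : 'I_2) : (if i == ord0 then y else z) = (if j == ord0 then y else z)
    -> i = j.
  have ynz : y != z by apply: contraTneq yz => ->; rewrite adjxx.
  case: i j => [[|[|i]] ?] [[|[|j]] ?] //=; try (by move=> _; apply: val_inj);
    by move/eqP; rewrite ?(negPf ynz) // eq_sym (negPf ynz).
have nxy b : x != (if b then y else z).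
  by case: b; [apply: contraNneq xz => ->|apply: contraNneq xy => ->; rewrite adjC].
have xW k : adj x (u k) by case: (hW _ (uW k)).
have yW k b : adj (if b then y else z) (u k) by case: (hW _ (uW k)) => ?; case: b.
have nadj (a b : G) : adj a b -> a <> b by move=> ab /(congr1 (adj a)); rewrite ab adjxx.
apply: (not_free (f := f)) hK.
  move=> [[i|i]|k] [[j|j]|l] //=.
  - by rewrite !ord1.
  - by move/eqP; rewrite (negPf (nxy _)).
  - by move=> h; case: (nadj _ _ (xW l) h).
  - by move/esym/eqP; rewrite (negPf (nxy _)).
  - by move/I2->.
  - by move=> h; case: (nadj _ _ (yW l (i == ord0)) h).
  - by move=> h; case: (nadj _ _ (xW k) (esym h)).
  - by move=> h; case: (nadj _ _ (yW k (j == ord0)) (esym h)).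
  - by move/u_inj->.
move=> [[i|i]|k] [[j|j]|l] /=.
- by rewrite adjxx /complete_adj !ord1.
- by case: (j == ord0); rewrite ?(negPf xy) ?(negPf xz).
- exact: xW.
- by rewrite adjC; case: (i == ord0); rewrite ?(negPf xy) ?(negPf xz).
- rewrite /complete_adj; have [->|ij] := eqVneq i j; first by rewrite adjxx.
  by case: i j ij => [[|[|i]] ?] [[|[|j]] ?] //=; rewrite adjC.
- exact: yW.
- by rewrite adjC xW.
- by rewrite adjC yW.
- exact: uu.
Qed.

Lemma no_P3_P2 x y z u v :
  is_free (disjoint_union (path_graph 3) (path_graph 2)) G ->
  adj x y -> adj y z -> ~~ adj x z -> x != z -> adj u v ->
  (forall a b, a \in [:: x; y; z] -> b \in [:: u; v] -> ~~ adj a b) -> False.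
Proof.
move=> hP xy yz xz xnz uv h.
pose f (w : disjoint_union (path_graph 3) (path_graph 2)) : G :=
  match w with
  | inl i => nth x [:: x; y; z] i
  | inr i => nth u [:: u; v] i
  end.
have h' (i : 'I_3) (j : 'I_2) : adj (nth x [:: x; y; z] i) (nth u [:: u; v] j) = false.
  by apply/negbTE/h; apply: mem_nth.
have nxy : x != y by apply: contraTneq xy => ->; rewrite adjxx.
have nyz : y != z by apply: contraTneq yz => ->; rewrite adjxx.
have nuv : u != v by apply: contraTneq uv => ->; rewrite adjxx.
have fP w w' : adj (f w) (f w') = adj w w'.
  case: w w' => [i|i] [j|j].
  - case: i j => [[|[|[|i]]] ?] [[|[|[|j]]] ?] //=; rewrite /path_adj /= ?adjxx //;
      by rewrite ?(negPf xz) // adjC ?(negPf xz).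
  - exact: (h' i j).
  - by rewrite adjC; apply: (h' j i).
  - case: i j => [[|[|i]] ?] [[|[|j]] ?] //=; rewrite /path_adj /= ?adjxx //.
    by rewrite adjC.
apply: (not_free (f := f)) fP hP.
(* A path vertex equal to one end of [u v] would be adjacent to the other end. *)
have distinct (i : 'I_3) (j : 'I_2) : nth x [:: x; y; z] i <> nth u [:: u; v] j.
  move=> e; have := h' i (if val j == 0 then ord_max else ord0).
  rewrite e; case: j {e} => [[|[|j]] ?] //=; first by rewrite uv.
  by rewrite adjC uv.
move=> [i|i] [j|j] /=.
- case: i j => [[|[|[|i]]] ?] [[|[|[|j]]] ?] //=;
    try (by move=> _; congr inl; apply: val_inj);
    move/eqP; rewrite ?(negPf nxy) ?(negPf nyz) ?(negPf xnz) // eq_sym;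
    by rewrite ?(negPf nxy) ?(negPf nyz) ?(negPf xnz).
- by move/distinct.
- by move/esym/distinct.
- case: i j => [[|[|i]] ?] [[|[|j]] ?] //=;
    try (by move=> _; congr inr; apply: val_inj);
    move/eqP; rewrite ?(negPf nuv) // eq_sym; by rewrite ?(negPf nuv).
Qed.

End Colouring.

(** * Vertices near a clique *)

Lemma subset_between (T : finType) (A B : {set T}) n :
  A \subset B -> #|A| <= n <= #|B| ->
  exists C : {set T}, [/\ A \subset C, C \subset B & #|C| = n].
Proof.
move=> AB /andP[An nB].
pose s := take (n - #|A|) (enum (B :\: A)).
have sBA x : x \in s -> x \in B :\: A by move/mem_take; rewrite mem_enum.
have szs : #|[set x in s]| = n - #|A|.
  rewrite cardsE (card_uniqP _) ?take_uniq ?enum_uniq // size_takel //.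
  by rewrite -cardE cardsDS // leq_sub2r.
exists (A :|: [set x in s]); split; first exact: subsetUl.
  rewrite subUset AB; apply/subsetP => x; rewrite inE => /sBA.
  by rewrite inE => /andP[].
rewrite cardsU szs disjoint_setI0 ?cards0 ?subn0 ?subnKC //.
rewrite -setI_eq0; apply/eqP/setP => x; rewrite !inE.
by apply/andP => -[xA /sBA]; rewrite inE xA.
Qed.

Section Near.
Variable G : sgraph.
Implicit Types (x y z : G) (S B K Q W : {set G}).

(** A vertex of [K] counts as missing itself, which puts a clique among its own near vertices. *)
Definition missed K x := K :\: nbhd x.

Definition near K := [set x | #|missed K x| <= 1].

Lemma in_missed K x a : (a \in missed K x) = (a \in K) && ~~ adj x a.
Proof. by rewrite !inE andbC. Qed.

Lemma missed_clique K x a : is_clique K -> x \in K -> a \in missed K x -> a = x.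
Proof.
move=> /is_cliqueP cK xK; rewrite in_missed => /andP[aK].
by apply: contraNeq => ax; apply: cK; rewrite // eq_sym.
Qed.

Lemma near_missed K x a b :
  x \in near K -> a \in missed K x -> b \in missed K x -> a = b.
Proof. by rewrite inE => /card_le1_eqP h ax bx; apply: h. Qed.

Lemma clique_near K : is_clique K -> K \subset near K.
Proof.
move=> cK; apply/subsetP => x xK; rewrite inE; apply/card_le1_eqP => a b.
by move=> /(missed_clique cK xK)-> /(missed_clique cK xK)->.
Qed.

Lemma far_missed K x : x \notin near K ->
  exists a b, [/\ a \in missed K x, b \in missed K x & a != b].
Proof. by rewrite inE -ltnNge => /card_gt1P. Qed.

Lemma near_missed_ex K x : maxset (@is_clique G) K -> exists a, a \in missed K x.
Proof.
move=> /maxsetP[cK mK].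
have [m0|[a]] := set_0Vmem (missed K x); last by exists a.
have xK a : a \in K -> adj x a.
  by move=> aK; have /setP/(_ a) := m0; rewrite in_missed inE aK /= => /negbFE.
have c1 : is_clique (x |: K).
  apply: cliqueU => //; first by apply/is_cliqueP => y z; rewrite !inE => /eqP-> /eqP->; rewrite eqxx.
  by move=> y z; rewrite inE => /eqP->; apply: xK.
have := mK _ c1 (subsetUr _ _) => /setP/(_ x); rewrite !inE eqxx /= => /esym/xK.
by rewrite adjxx.
Qed.

Lemma maxset_clique K : is_clique K -> #|K| = clique_number G ->
  maxset (@is_clique G) K.
Proof.
move=> cK Kw; apply/maxsetP; split=> // B cB KB.
by apply/esym/eqP; rewrite eqEcard KB Kw clique_leq.
Qed.

(** The colour of a near vertex is the position in [K] of the one vertex it misses. For a maximal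
    [K] some vertex is always missed, so the default [x] does not occur. *)
Definition shade K x := index (odflt x [pick a in missed K x]) (enum K).

Lemma shadeE K x a : x \in near K -> a \in missed K x ->
  shade K x = index a (enum K).
Proof.
move=> xK ax; rewrite /shade; case: pickP => [b bx|/(_ a)]; last by rewrite ax.
by rewrite /= (near_missed xK bx ax).
Qed.

Lemma shade_lt K x : maxset (@is_clique G) K -> x \in near K ->
  shade K x < #|K|.
Proof.
move=> mK xK; have [a ax] := near_missed_ex x mK.
rewrite (shadeE xK ax) cardE index_mem mem_enum.
by move: ax; rewrite in_missed => /andP[].
Qed.

Lemma shade_inj K x y : maxset (@is_clique G) K ->
  x \in near K -> y \in near K -> shade K x = shade K y ->
  exists2 a, a \in missed K x & a \in missed K y.
Proof.
move=> mK xK yK; have [a ax] := near_missed_ex x mK.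
have [b yb] := near_missed_ex y mK.
rewrite (shadeE xK ax) (shadeE yK yb) => e.
have aK : a \in enum K by rewrite mem_enum; move: ax; rewrite in_missed => /andP[].
have bK : b \in enum K by rewrite mem_enum; move: yb; rewrite in_missed => /andP[].
by exists a; rewrite // (index_inj a aK bK e).
Qed.

(** Adjacent near vertices that both miss [a] could replace [a] in [K], giving a larger clique;
    hence [shade] is a proper colouring. *)
Lemma maximum_near_col K : is_clique K -> #|K| = clique_number G ->
  col (near K) (clique_number G).
Proof.
move=> cK Kw; have mK := maxset_clique cK Kw.
exists (shade K); split=> [x xK|x y xK yK xy]; first by rewrite -Kw shade_lt.
apply/eqP => /(shade_inj mK xK yK)[a ax ay].
have aK : a \in K by move: ax; rewrite in_missed => /andP[].
have out u : u \in near K -> a \in missed K u -> u \notin K :\ a.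
  move=> uK au; rewrite !inE negb_and negbK; case: (boolP (u \in K)) => [uK'|_]; last by rewrite orbT.
  by rewrite (missed_clique cK uK' au) eqxx.
have adjK u b : u \in near K -> a \in missed K u -> b \in K :\ a -> adj u b.
  move=> uK au; rewrite !inE => /andP[ba bK]; apply: contraNT ba => ub.
  by rewrite (near_missed uK au (b := b)) ?eqxx // in_missed bK.
have c1 : is_clique ([set x; y] :|: K :\ a).
  apply: cliqueU; [exact: clique2|exact: cliqueS (subD1set _ _) cK|].
  by move=> u b; rewrite !inE => /orP[] /eqP-> ?; apply: adjK; rewrite // !inE.
have := clique_leq c1; rewrite -Kw -setUA !cardsU1 (cardsD1 a K) aK.
rewrite !inE negb_or; have := out _ yK ay; have := out _ xK ax; rewrite !inE => -> -> /=.
have -> : x != y by apply: contraTneq xy => ->; rewrite adjxx.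
by rewrite /=; lia.
Qed.

(** * Near and far vertices when (K1 u K2) + Kp is excluded *)

Variable p : nat.
Hypothesis hK : is_free (join (disjoint_union (complete_graph 1) (complete_graph 2))
                              (complete_graph p)) G.

(** Two missed vertices form a K2 which, with [x] as the K1, is complete to the neighbours of [x] in
    [K]. *)
Lemma far_degree K x : is_clique K -> x \notin near K -> #|K :&: nbhd x| < p.
Proof.
move=> cK /far_missed[a [b []]]; rewrite !in_missed.
move=> /andP[aK xa] /andP[bK xb] ab; have /is_cliqueP kP := cK.
apply: (no_K1K2_Kp (x := x) (y := a) (z := b)) hK _ _ _ _ _ => //.
- exact: cliqueS (subsetIl _ _) cK.
- exact: kP.
- move=> w; rewrite !inE => /andP[wK xw]; split=> //; apply: kP => //.
    by apply: contraNneq xa => ->.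
  by apply: contraNneq xb => ->.
Qed.

Lemma common_nbhd K x y : x \in near K -> y \in near K ->
  #|K| <= #|K :&: nbhd x :&: nbhd y| + 2.
Proof.
rewrite !inE => xK yK.
have : K \subset (K :&: nbhd x :&: nbhd y) :|: (missed K x :|: missed K y).
  by apply/subsetP => a aK; rewrite !inE aK; case: adj; case: adj.
move/subset_leq_card/leq_trans; apply.
apply: leq_trans (leq_card_setU _ _) _; rewrite leq_add2l.
by apply: leq_trans (leq_card_setU _ _) _; apply: leq_add xK yK.
Qed.

(** If [v] misses [b] and a non-neighbour [u] of [v] does not, then [v] and the edge [u b] are
    complete to the common neighbours of [u] and [v] in [K], at least [p] in number. With
    [missed_nonadj] this makes [near K] complete multipartite, with parts named by the missed
    vertex. *)
Lemma near_nonadj_missed K x y : is_clique K -> p + 2 <= #|K| ->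
  x \in near K -> y \in near K -> ~~ adj x y -> missed K x = missed K y.
Proof.
move=> cK pK; have /is_cliqueP kP := cK.
suff sub u v : u \in near K -> v \in near K -> ~~ adj u v ->
    missed K v \subset missed K u.
  by move=> xK yK xy; apply/eqP; rewrite eqEsubset !sub // adjC.
move=> uK vK uv; apply/subsetP => b; rewrite !in_missed => /andP[bK vb].
rewrite bK /=; apply/negP => ub.
have := common_nbhd uK vK; suff : #|K :&: nbhd u :&: nbhd v| < p by lia.
apply: (no_K1K2_Kp (x := v) (y := u) (z := b)) hK _ _ _ _ _ => //.
- by apply: cliqueS cK; rewrite -setIA subsetIl.
- by rewrite adjC.
- move=> w; rewrite !inE => /andP[/andP[wK uw] vw]; split=> //; apply: kP => //.
  by apply: contraNneq vb => ->.
Qed.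

Lemma missed_nonadj K x y a : is_clique K -> p + 2 <= #|K| ->
  x \in near K -> y \in near K -> a \in missed K x -> a \in missed K y ->
  ~~ adj x y.
Proof.
move=> cK pK xK yK; have /is_cliqueP kP := cK.
rewrite !in_missed => /andP[aK xa] /andP[_ ya]; apply/negP => xy.
have := common_nbhd xK yK; suff : #|K :&: nbhd x :&: nbhd y| < p by lia.
apply: (no_K1K2_Kp (x := a) (y := x) (z := y)) hK _ _ _ _ _ => //.
- by apply: cliqueS cK; rewrite -setIA subsetIl.
- by rewrite adjC.
- by rewrite adjC.
- move=> w; rewrite !inE => /andP[/andP[wK xw] yw]; split=> //; apply: kP => //.
  by apply: contraNneq xa => ->.
Qed.

(** The parts of [near K] in which [x] has a neighbour, each named by the vertex of [K] that it
    misses. *)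
Definition seen K x :=
  [set a in K | [exists y in near K, adj x y && (a \in missed K y)]].

(* If [x] saw [p] parts of the complete multipartite graph [near K], then, by
   choosing these parts to include the ones of the neighbours of [x] in [K], two
   vertices of [K] in other parts would complete a (K1 u K2) + Kp. *)
Lemma far_seen K x : is_clique K -> p + 2 <= #|K| -> x \notin near K ->
  #|seen K x| < p.
Proof.
move=> cK pK xK; rewrite ltnNge; apply/negP => pS.
have /is_cliqueP kP := cK; have /subsetP KnK := clique_near cK.
have NS : K :&: nbhd x \subset seen K x.
  apply/subsetP => a; rewrite !inE => /andP[aK xa]; rewrite aK /=.
  by apply/existsP; exists a; rewrite KnK // xa !inE aK adjxx.
have [|C [NC CS Cp]] := subset_between (n := p) NS.
  by rewrite pS (ltnW (far_degree cK xK)).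
(* [r c] is a neighbour of [x] in the part named [c]; these representatives will form the Kp. *)
pose r c := odflt x [pick y in near K | adj x y && (c \in missed K y)].
have rP c : c \in C -> [/\ r c \in near K, adj x (r c) & c \in missed K (r c)].
  move/(subsetP CS); rewrite inE => /andP[_ /existsP[y yP]].
  rewrite /r; case: pickP => [z /and3P[]//|/(_ y)].
  by rewrite yP.
have r_inj : {in C &, forall c d, missed K (r c) = missed K (r d) -> c = d}.
  move=> c d /rP[cK' _ cc] /rP[dK _ dd] e; apply: (near_missed dK) => //.
  by rewrite -e.
have CK : #|C| + 2 <= #|K| by rewrite Cp.
have : 1 < #|K :\: C|.
  have CK' : C \subset K by apply: subset_trans CS _; apply/subsetP => c; rewrite inE => /andP[].
  by rewrite cardsDS //; lia.
move=> /card_gt1P[a [b []]]; rewrite !inE => /andP[aC aK] /andP[bC bK] ab.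
have offC u : u \in K -> u \notin C -> ~~ adj x u.
  by move=> uK; apply: contraNN => xu; apply: (subsetP NC); rewrite !inE uK.
have offr u c : u \in K -> u \notin C -> c \in C -> adj u (r c).
  move=> uK uC cC; have [rK _ cr] := rP c cC; rewrite adjC.
  apply: contraNT uC => ru; rewrite (near_missed rK (a := u) (b := c)) //.
  by rewrite in_missed uK.
have : #|r @: C| < p.
  apply: (no_K1K2_Kp (x := x) (y := a) (z := b)) hK _ _ _ _ _.
  - apply/is_cliqueP => _ _ /imsetP[c cC ->] /imsetP[d dC ->].
    apply: contraNT => cd; have [rc _ _] := rP c cC; have [rd _ _] := rP d dC.
    by rewrite (r_inj _ _ cC dC (near_nonadj_missed cK pK rc rd cd)).
  - exact: kP.
  - exact: offC.
  - exact: offC.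
  - by move=> _ /imsetP[c cC ->]; have [_ xr _] := rP c cC; split=> //; apply: offr.
rewrite card_in_imset ?Cp ?ltnn // => c d cC dC e.
by apply: r_inj; rewrite // e.
Qed.

(** With [near K] coloured by [shade], a vertex of [S] meets at most [p - 1] colours there, and it
    has fewer than [clique_number G] neighbours in [S], so the greedy extension succeeds. *)
Lemma near_cluster_col K S : maxset (@is_clique G) K -> p + 2 <= #|K| ->
  cluster S -> [disjoint S & near K] ->
  col (near K :|: S) (clique_number G + (p - 1)).
Proof.
move=> mK pK cS dS; have /maxsetP[cK _] := mK.
have far x : x \in S -> x \notin near K by move=> xS; rewrite (disjointFr dS).
have Kw := clique_leq cK.
apply: (@greedy_extension G _ (near K) S (shade K)
  (fun x => [seq index a (enum K) | a <- enum (seen K x)])).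
- by move=> x xK; have := shade_lt mK xK; lia.
- move=> x y xK yK xy; apply/eqP => /(shade_inj mK xK yK)[a ax ay].
  by have := missed_nonadj cK pK xK yK ax ay; rewrite xy.
- exact: far.
- move=> x y xS yK xy; have [a ay] := near_missed_ex y mK.
  rewrite (shadeE yK ay); apply: (map_f (fun a => index a (enum K))).
  rewrite mem_enum inE.
  have -> /= : a \in K by move: ay; rewrite in_missed => /andP[].
  by apply/existsP; exists y; rewrite yK xy.
- move=> x xS; rewrite size_map -cardE; have := far_seen cK pK (far _ xS).
  have := cluster_degree cS xS (fun Q _ => @clique_leq G Q); lia.
Qed.

End Near.

(** * Cells outside a maximum clique *)

Section Levels.
Variables (p : nat) (G : sgraph).
Hypothesis hP : is_free (disjoint_union (path_graph 3) (path_graph 2)) G.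
Hypothesis hK : is_free (join (disjoint_union (complete_graph 1) (complete_graph 2))
                              (complete_graph p)) G.
Variable A : {set G}.
Hypothesis cA : is_clique A.
Hypothesis Aw : #|A| = clique_number G.
Implicit Types (x y z a b c : G) (S B K Q W : {set G}).

Definition rank a := index a (enum A).

Definition prefix j := [set c in take j (enum A)].

(* The ranks of the first two vertices of [A] not adjacent to [x]. *)
Definition pos1 x := find (fun c => ~~ adj x c) (enum A).

Definition pos2 x := find (fun c => ~~ adj x c && (rank c != pos1 x)) (enum A).

Lemma rank_inj : {in A &, injective rank}.
Proof. by move=> a b aA bA; apply: index_inj; rewrite ?mem_enum. Qed.

Lemma rank_lt a : a \in A -> rank a < clique_number G.
Proof. by move=> aA; rewrite -Aw cardE index_mem mem_enum. Qed.

Lemma in_prefix j c : (c \in prefix j) = (c \in A) && (rank c < j).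
Proof.
rewrite inE; have [cA'|cA'] := boolP (c \in A); first by rewrite in_take ?mem_enum.
by apply: contraNF cA' => /mem_take; rewrite mem_enum.
Qed.

Lemma prefix_sub j : prefix j \subset A.
Proof. by apply/subsetP => c; rewrite in_prefix => /andP[]. Qed.

Lemma card_prefix j : j <= clique_number G -> #|prefix j| = j.
Proof.
rewrite -Aw => jA; rewrite cardsE (card_uniqP _) ?take_uniq ?enum_uniq //.
by rewrite size_takel // -cardE.
Qed.

Lemma find_rank (P : pred G) c : c \in A -> P c -> find P (enum A) <= rank c.
Proof.
move=> cA' Pc; rewrite leqNgt; apply/negP => /(before_find c).
by rewrite nth_index ?mem_enum // Pc.
Qed.

Lemma find_elem (P : pred G) c : c \in A -> P c ->
  exists a, [/\ a \in A, P a & rank a = find P (enum A)].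
Proof.
move=> cA' Pc; have hs : has P (enum A) by apply/hasP; exists c; rewrite ?mem_enum.
exists (nth c (enum A) (find P (enum A))); split.
- by rewrite -mem_enum mem_nth // -has_find.
- exact: nth_find.
- by rewrite /rank index_uniq ?enum_uniq // -has_find.
Qed.

Lemma posP x : x \notin near A -> exists a b,
  [/\ a \in missed A x, b \in missed A x, rank a = pos1 x, rank b = pos2 x &
      pos1 x < pos2 x].
Proof.
move=> /far_missed[c [d []]]; rewrite !in_missed => /andP[cA' xc] /andP[dA xd] cd.
have [a [aA xa ra]] := find_elem (P := fun c => ~~ adj x c) cA' xc.
pose P c := ~~ adj x c && (rank c != pos1 x).
have [e eA Pe] : exists2 e, e \in A & P e.
  have [ec|] := eqVneq (rank c) (pos1 x); last by exists c; rewrite // /P xc.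
  exists d => //; rewrite /P xd -ec.
  by apply: contra_neq cd => /(rank_inj dA cA') ->.
have [b [bA /andP[xb rb] rb']] := find_elem (P := P) eA Pe.
rewrite -[find P _]/(pos2 x) in rb'.
exists a, b; rewrite !in_missed aA bA; split=> //.
rewrite ltn_neqAle -{2}rb' find_rank // andbT.
by apply: contraNneq rb => ->; rewrite rb'.
Qed.

Lemma pos_adj x c : c \in A -> rank c < pos2 x -> rank c != pos1 x -> adj x c.
Proof.
move=> cA' + rc; apply: contraTT => xc; rewrite -leqNgt.
by apply: find_rank; rewrite // xc rc.
Qed.

Lemma pos2_lt x : x \notin near A -> 0 < pos2 x < clique_number G.
Proof.
move=> /posP[a [b [_ + _ <- ab]]]; rewrite in_missed => /andP[bA _].
by rewrite rank_lt // andbT (leq_ltn_trans _ ab).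
Qed.

Lemma out_A x : x \notin near A -> x \notin A.
Proof. by apply: contraNN; apply: (subsetP (clique_near cA)). Qed.

(** An induced P3 in [S] would form a P3 u P2 with the edge [a b]. *)
Lemma missed_pair_cluster a b S : a \in A -> b \in A -> a != b ->
  (forall x, x \in S -> ~~ adj x a /\ ~~ adj x b) -> cluster S.
Proof.
move=> aA bA ab hS x y z xS yS zS xy yz xz; apply/negPn/negP => nxz.
have /is_cliqueP kA := cA.
apply: (no_P3_P2 hP xy yz nxz xz (kA _ _ aA bA ab)) => u w uxyz.
have [ua ub] : ~~ adj u a /\ ~~ adj u b.
  by apply: hS; move: uxyz; rewrite !inE => /or3P[] /eqP->.
by rewrite !inE => /orP[] /eqP->.
Qed.

(** Two missed vertices of [Q] would form a P3 u P2 with the path [z], [a], [b]. *)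
Lemma separating_missed a b Q z : a \in A -> b \in A -> z \notin A ->
  is_clique Q -> (forall x, x \in Q -> ~~ adj x a /\ ~~ adj x b) ->
  adj z a -> ~~ adj z b -> #|missed Q z| <= 1.
Proof.
move=> aA bA zA /is_cliqueP kQ hQ za zb; rewrite leqNgt; apply/negP.
move=> /card_gt1P[y [y' []]]; rewrite !in_missed => /andP[yQ zy] /andP[yQ' zy'] yy.
have /is_cliqueP kA := cA.
have ab : adj a b by apply: kA => //; apply: contraTneq za => ->.
have zb' : z != b by apply: contraNneq zA => ->.
apply: (no_P3_P2 hP za ab zb zb' (kQ _ _ yQ yQ' yy)) => u w.
have [ya yb] := hQ _ yQ; have [ya' yb'] := hQ _ yQ'.
rewrite !inE => /or3P[] /eqP-> /orP[] /eqP->; rewrite // adjC //.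
Qed.

Definition cell (i j : nat) := [set x | [&& x \notin near A, pos1 x == i & pos2 x == j]].

(** A vertex of [A] is determined by its rank, so the same pair [a], [b] serves the whole cell. *)
Lemma cellP (i j : nat) x : x \in cell i j -> exists a b,
  [/\ a \in A, b \in A, rank a = i, rank b = j & i < j] /\
  forall y, y \in cell i j -> ~~ adj y a /\ ~~ adj y b.
Proof.
rewrite inE => /and3P[xA /eqP pi /eqP pj].
have [a [b []]] := posP xA; rewrite pi pj !in_missed.
move=> /andP[aA _] /andP[bA _] ra rb ij; exists a, b; split=> // y.
rewrite inE => /and3P[yA /eqP qi /eqP qj].
have [a' [b' []]] := posP yA; rewrite qi qj !in_missed.
move=> /andP[aA' ya] /andP[bA' yb] ra' rb' _.
have -> : a = a' by apply: rank_inj; rewrite // ra.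
have -> : b = b' by apply: rank_inj; rewrite // rb.
by split.
Qed.

Lemma cell_cluster (i j : nat) : cluster (cell i j).
Proof.
move=> x y z xC; have [a [b [[aA bA ra rb ij] h]]] := cellP xC.
apply: (missed_pair_cluster aA bA _ h) xC.
by apply: contraTneq ij => ab; rewrite -ra -rb ab ltnn.
Qed.

(* The [j - 1] other vertices of [A] of rank below [j] are complete to the cell,
   so [Q] together with them is a clique of order at least [p + 2]. *)
Definition big (i j : nat) := [exists Q : {set G},
  [&& Q \subset cell i j, is_clique Q & p + 2 <= #|Q| + (j - 1)]].

Lemma small_cell_col (i j : nat) : ~~ big i j -> col (cell i j) (p + 2 - j).
Proof.
move=> nb; apply: cluster_col; first exact: cell_cluster.
move=> Q QC cQ; have : ~~ (p + 2 <= #|Q| + (j - 1)).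
  by apply: contraNN nb => h; apply/existsP; exists Q; rewrite QC cQ.
by lia.
Qed.

(* Such a [z] is adjacent to exactly one of the two vertices [a], [b] of [A] that
   the cell misses, so the P3 on [z], [a], [b] forces [z] to miss at most one
   vertex of the large clique [Q] of the cell. *)
Lemma big_cell_near (i j : nat) : j <= p + 2 -> big i j -> exists K,
  [/\ maxset (@is_clique G) K, p + 2 <= #|K| &
      forall z, z \notin near A ->
        pos2 z = j \/ j < pos2 z /\ (pos1 z = i \/ pos1 z = j) ->
        z \in near K :|: cell i j].
Proof.
move=> jp /existsP[Q /and3P[QC cQ Qj]].
have [x xQ] : exists x, x \in Q.
  have [Q0|[x]] := set_0Vmem Q; last by exists x.
  by move: Qj; rewrite Q0 cards0; lia.
have sQ y : y \in Q -> y \in cell i j by apply: (subsetP QC).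
have [a [b [[aA bA ra rb ij] h]]] := cellP (sQ x xQ).
have hQ y : y \in Q -> ~~ adj y a /\ ~~ adj y b by move/sQ/h.
pose T := prefix j :\ a.
have TP c : c \in T -> [/\ c \in A, rank c < j & rank c != i].
  rewrite in_setD1 in_prefix => /and3P[ca cA' rc]; split=> //.
  by apply: contra_neq ca => e; apply: rank_inj; rewrite // ra.
have cT : is_clique T.
  by apply: cliqueS cA; apply: subset_trans (subD1set _ _) (prefix_sub _).
have cTQ : is_clique (T :|: Q).
  apply: cliqueU => // c y /TP[cA' rc ri] /sQ; rewrite inE adjC.
  by move=> /and3P[_ /eqP qi /eqP qj]; apply: pos_adj; rewrite ?qj ?qi.
have jw : j < clique_number G by rewrite -rb rank_lt.
have cardTQ : #|T :|: Q| = #|Q| + (j - 1).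
  rewrite cardsU (_ : T :&: Q = set0).
    have : #|prefix j| = j by rewrite card_prefix // ltnW.
    rewrite (cardsD1 a) in_prefix aA ra ij cards0 /= -/T; lia.
  apply/setP => y; rewrite in_setI in_set0; apply/andP => -[/TP[yA _ _] /sQ].
  by rewrite inE => /and3P[/out_A]; rewrite yA.
have [K mK TQK] := maxset_exists cTQ; have /maxsetP[cK _] := mK.
exists K; split=> //.
  by apply: leq_trans Qj _; rewrite -cardTQ subset_leq_card.
(* Such a [z] misses at most two of the [p + 2] or more vertices of [T :|: Q], so it sees at least
   [p] vertices of [K], too many for a far vertex. *)
have nearK z : z \notin near A -> #|missed T z| <= 1 -> #|missed Q z| <= 1 ->
    z \in near K.
  move=> zA zT zQ; apply/negPn/negP => /(far_degree hK cK).
  have : (T :|: Q) :\: (missed T z :|: missed Q z) \subset K :&: nbhd z.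
    apply/subsetP => y; rewrite in_setI in_setD in_setU !in_missed => /andP[yn yTQ].
    rewrite (subsetP TQK) //= inE; move: yn yTQ; rewrite in_setU.
    by case: (y \in T); case: (y \in Q); case: adj.
  move=> /subset_leq_card; have := (leq_card_setU (missed T z) (missed Q z)).1.
  have := cardsD (T :|: Q) (missed T z :|: missed Q z).
  have := subset_leq_card (subsetIr (T :|: Q) (missed T z :|: missed Q z)).
  move: cardTQ Qj zT zQ;  lia.
move=> z zA zj; rewrite in_setU.
have zA' := out_A zA; have [a' [b' []]] := posP zA; rewrite !in_missed.
move=> /andP[aA' za] /andP[bA' zb] ra' rb' _.
have sym u : u \in Q -> ~~ adj u b /\ ~~ adj u a by move/hQ => [].
(* When [pos2 z = j], the only vertex of rank below [j] that [z] misses has rank [pos1 z]; unless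
   this is [i], [z] sees [a] and misses [b]. *)
case: zj => [zj|[zj ijz]].
  have [zi|zi] := eqVneq (pos1 z) i; first by rewrite [z \in cell i j]inE zA zi zj !eqxx orbT.
  apply/orP; left; apply: nearK => //.
    apply/card_le1_eqP => c d; rewrite !in_missed.
    move=> /andP[/TP[cA' rc _] zc] /andP[/TP[dA' rd _] zd].
    have eqi u : u \in A -> rank u < j -> ~~ adj z u -> rank u = pos1 z.
      by move=> uA uj; apply: contraNeq => ui; apply: pos_adj; rewrite // zj.
    by apply: rank_inj; rewrite // (eqi c) // (eqi d).
  apply: (separating_missed aA bA zA' cQ hQ).
    by apply: pos_adj; rewrite // ra ?zj // eq_sym.
  have -> : b = b' by apply: rank_inj; rewrite // rb rb'.
  by [].
(* When [j < pos2 z], the only vertex of rank at most [j] that [z] misses is [a] or [b], so [z]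
   misses nothing in [T] and sees the other one of [a] and [b]. *)
apply/orP; left; apply: nearK => //.
  rewrite leqNgt; apply/negP => /card_gt1P[c [_ [+ _ _]]]; rewrite in_missed.
  move=> /andP[/TP[cA' rc ri]]; rewrite pos_adj ?(ltn_trans rc) //.
  by case: ijz => -> //; rewrite neq_ltn rc.
case: ijz => zi; [apply: (separating_missed bA aA zA' cQ sym)|
                  apply: (separating_missed aA bA zA' cQ hQ)].
- by apply: pos_adj; rewrite // rb ?zi // gtn_eqF.
- have -> : a = a' by apply: rank_inj; rewrite // ra ra'.
  by [].
- by apply: pos_adj; rewrite // ra ?zi ?(ltn_trans ij) // ltn_eqF.
- have -> : b = a' by apply: rank_inj; rewrite // rb ra'.
  by [].
Qed.

Lemma big_cell_col (i j : nat) : j <= p + 2 -> big i j ->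
  col [set z | (z \notin near A) &&
    ((pos2 z == j) || (j < pos2 z) && ((pos1 z == i) || (pos1 z == j)))]
    (clique_number G + (p - 1)).
Proof.
move=> jp /(big_cell_near jp)[K [mK pK h]].
(* Cell vertices that are near [K] get their colour from [near K]; only the rest form the
   cluster. *)
apply: colS (near_cluster_col hK mK pK (S := cell i j :\: near K) _ _).
- apply/subsetP => z; rewrite inE => /andP[zA zj].
  have : z \in near K :|: cell i j.
    apply: h => //; case/orP: zj => [/eqP->|/andP[zj ij]]; [by left|right].
    by split=> //; case/orP: ij => /eqP->; [left|right].
  by rewrite !in_setU in_setD => /orP[->//|->]; case: (_ \in near K).
- move=> x y z; rewrite !in_setD => /andP[_ xC] /andP[_ yC] /andP[_ zC].
  exact: cell_cluster xC yC zC.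
- by rewrite disjoint_sym disjoints_subset; apply/subsetP => y yK; rewrite inE in_setD yK.
Qed.

(** * The tail: far vertices whose second missed vertex comes late in [A] *)

Lemma P3_degree x y z : adj x y -> adj y z -> ~~ adj x z -> x != z ->
  clique_number G <= #|A :&: (nbhd x :|: nbhd y :|: nbhd z)| + 1.
Proof.
move=> xy yz xz xnz; rewrite -Aw -(cardsID (nbhd x :|: nbhd y :|: nbhd z) A).
rewrite leq_add2l leqNgt; apply/negP => /card_gt1P[a [b []]].
rewrite !inE !negb_or => /andP[/andP[/andP[xa ya] za] aA].
move=> /andP[/andP[/andP[xb yb] zb] bA] ab.
have /is_cliqueP kA := cA.
(* Two vertices of [A] unseen by the path would be the P2 of a P3 u P2. *)
apply: (no_P3_P2 hP xy yz xz xnz (kA _ _ aA bA ab)) => u w.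
by rewrite !inE => /or3P[] /eqP-> /orP[] /eqP->.
Qed.

(** Of the at most [p - 1] neighbours of [x] in [A], at least [m.-1] lie in [prefix m], where [x]
    misses at most one vertex. *)
Lemma degree_off_prefix x m : m <= clique_number G -> x \notin near A ->
  m <= pos2 x -> #|(A :&: nbhd x) :\: prefix m| <= p - 1 - m.-1.
Proof.
move=> mw xA mx; have := far_degree hK cA xA.
rewrite -(cardsID (prefix m)) => deg.
have le1 : #|prefix m :\: nbhd x| <= 1.
  apply/card_le1_eqP => c d; rewrite !in_setD !in_prefix !inE.
  move=> /and3P[xc cA' rc] /and3P[xd dA rd].
  have eqi u : u \in A -> rank u < m -> ~~ adj x u -> rank u = pos1 x.
    by move=> uA um; apply: contraNeq => ui; apply: pos_adj; rewrite // (leq_trans um).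
  by apply: rank_inj; rewrite // (eqi c) // (eqi d).
have := card_prefix mw; rewrite -(cardsID (nbhd x)).
have -> : prefix m :&: nbhd x = A :&: nbhd x :&: prefix m.
  by rewrite setIAC (setIidPr (prefix_sub m)).
move: deg le1; lia.
Qed.

(** An induced P3 in the tail sees at most [m + 3 * (p - 1 - m.-1)] vertices of [A], yet it must see
    all but one. So the tail is a cluster. *)
Lemma tail_col m : p + 2 <= clique_number G ->
  m + 3 * (p - 1 - m.-1) + 2 <= clique_number G ->
  col (near A :|: [set x | (x \notin near A) && (m <= pos2 x)])
      (clique_number G + (p - 1)).
Proof.
move=> pw mw; have mw' : m <= clique_number G by lia.
apply: (near_cluster_col hK (maxset_clique cA Aw)); first by rewrite Aw.
  move=> x y z; rewrite !inE -!ltnNge => /andP[xA xm] /andP[yA ym] /andP[zA zm].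
  have far u : 1 < #|missed A u| -> u \notin near A by rewrite inE -ltnNge.
  have dx := degree_off_prefix mw' (far _ xA) xm.
  have dy := degree_off_prefix mw' (far _ yA) ym.
  have dz := degree_off_prefix mw' (far _ zA) zm.
  move=> xy yz xnz; apply/negPn/negP => xz.
  have := P3_degree xy yz xz xnz.
  have : A :&: (nbhd x :|: nbhd y :|: nbhd z) \subset prefix m :|:
    ((A :&: nbhd x) :\: prefix m :|: (A :&: nbhd y) :\: prefix m
      :|: (A :&: nbhd z) :\: prefix m).
    apply/subsetP => c; rewrite !(in_setU, in_setI, in_setD) => /andP[-> /=].
    by case: (c \in prefix m).
  move/subset_leq_card => h1.
  have h2 := (leq_card_setU (prefix m) ((A :&: nbhd x) :\: prefix m :|:
    (A :&: nbhd y) :\: prefix m :|: (A :&: nbhd z) :\: prefix m)).1.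
  have h3 := (leq_card_setU ((A :&: nbhd x) :\: prefix m :|:
    (A :&: nbhd y) :\: prefix m) ((A :&: nbhd z) :\: prefix m)).1.
  have h4 := (leq_card_setU ((A :&: nbhd x) :\: prefix m)
    ((A :&: nbhd y) :\: prefix m)).1.
  move: h1 h2 h3 h4 dx dy dz (card_prefix mw'); lia.
by rewrite disjoint_sym disjoints_subset; apply/subsetP => y yA; rewrite in_setC in_set yA.
Qed.

(* Ranks count from 0; a level carries the paper's index [j], which counts from 1. *)
Definition level j := [set x in ~: near A | (pos2 x).+1 == j].

Lemma in_level j x :
  (x \in level j) = (x \notin near A) && ((pos2 x).+1 == j).
Proof. by rewrite in_set in_setC. Qed.

Lemma level_small_col j : (forall i, i < j.-1 -> ~~ big i j.-1) ->
  col (level j) ((j - 1) * (p + 3 - j)).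
Proof.
move=> h; have [j0|j0] := posnP j.
  by apply: colS (colW _ (col0 G)) => //; apply/subsetP => x; rewrite in_level j0 andbF.
have -> : (j - 1) * (p + 3 - j) = \sum_(0 <= i < j.-1) (p + 3 - j).
  by rewrite sum_nat_const_nat subn0 subn1.
apply: colS (@col_fibres _ pos1 (level j) 0 j.-1 (fun=> p + 3 - j) _).
  apply/subsetP => x xj; rewrite inE xj /=; move: xj; rewrite in_level.
  by move=> /andP[/posP[a [b [_ _ _ _ +]]] /eqP <-].
move=> i /h nb; have -> : p + 3 - j = p + 2 - j.-1 by lia.
apply: colS (small_cell_col nb); apply/subsetP => x; rewrite !in_set.
by move=> /andP[/andP[-> /eqP <-] ->]; rewrite /= eqxx.
Qed.

Lemma level_big_col i j : j.-1 <= p + 2 -> big i j.-1 ->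
  col (level j) (clique_number G + (p - 1)).
Proof.
move=> jp /(big_cell_col jp); apply: colS; apply/subsetP => x; rewrite !in_set.
by move=> /andP[-> /eqP <-]; rewrite eqxx.
Qed.

Lemma level_col j n : j.-1 <= p + 2 -> (j - 1) * (p + 3 - j) <= n ->
  clique_number G + (p - 1) <= n -> col (level j) n.
Proof.
move=> jp jn wn; have [/existsP[i bi]|nb] := boolP [exists i : 'I_j.-1, big i j.-1].
  exact: colW wn (level_big_col jp bi).
apply: colW jn (level_small_col _) => i ij.
by apply: contraNN nb => bi; apply/existsP; exists (Ordinal ij).
Qed.

(** Level 3 has [pos2] equal to 2, hence [pos1] equal to 0 or 1. If cell (0, 1) is big, its clique
    therefore handles both levels at once; otherwise level 2 costs only [p + 1]. *)
Lemma low_levels_col n : p + 1 + 2 * p <= n ->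
  p + 1 + (clique_number G + (p - 1)) <= n -> col (level 2 :|: level 3) n.
Proof.
move=> n1 n2; have [b|nb] := boolP (big 0 1).
  apply: (colW _ (colS _ (big_cell_col _ b))); [by lia| |by lia].
  apply/subsetP => x; rewrite in_setU !in_level => /orP[] /andP[xA /eqP[xj]]; rewrite in_set xA xj //=.
  have [a [c [_ _ _ _]]] := posP xA; rewrite xj.
  by case: (pos1 x) => [|[]].
apply: colW (_ : p + 1 + (n - (p + 1)) <= n) _; first by lia.
apply: colU.
  apply: colW (level_small_col (j := 2) _); first by lia.
  by case.
by apply: level_col; lia.
Qed.

Lemma graph_cover m :
  setT \subset (near A :|: [set x | (x \notin near A) && (m <= pos2 x)])
    :|: [set x in ~: near A | 2 <= (pos2 x).+1 < m.+1].
Proof.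
apply/subsetP => x _; rewrite 2!in_setU 2![x \in [set _ | _]]in_set in_setC.
case: (boolP (x \in near A)) => [//|xA] /=.
by have /andP[x0 _] := pos2_lt xA; lia.
Qed.

End Levels.

(** * The four ranges of the clique number *)

Theorem theorem3p5 (p : nat) (hp : 2 <= p) (G : sgraph)
  (hP : is_free (disjoint_union (path_graph 3) (path_graph 2)) G)
  (hK : is_free (join (disjoint_union (complete_graph 1) (complete_graph 2))
                      (complete_graph p)) G) :
  [/\ 3 <= clique_number G <= p + 1 ->
        chromatic_number G <=
          clique_number G + \sum_(2 <= j < p + 2) (j - 1) * (p + 3 - j),
      forall k : nat, k + 5 <= 2 * p -> clique_number G = p + 2 + k ->
        chromatic_number G <=
          clique_number G + 7 * (p - 1)
            + \sum_(4 <= j < (p - k %/ 2) + 1) (j - 1) * (p + 3 - j),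
      clique_number G = 3 * p - 2 ->
        chromatic_number G <= clique_number G + (4 * p - 3)
    & 3 * p - 1 <= clique_number G ->
        chromatic_number G <= clique_number G + (p - 1)].
Proof.
have [A cA Aw] := max_clique_exists G.
split.
- move=> /andP[w3 wp]; apply: chromatic_le.
  (* A big cell would give a clique of order [p + 2]. *)
  have nb i j : j <= p + 2 -> ~~ big p A i j.
    move=> jp; apply/negP => /(big_cell_near hP hK cA Aw jp)[K [mK pK _]].
    have /maxsetP[cK _] := mK; have := clique_leq cK; lia.
  apply: colS (colU (maximum_near_col cA Aw) (col_fibres (J := fun x => (pos2 A x).+1) (S := ~: near A) (a := 2) (b := p + 2) _)).
    apply/subsetP => x _; rewrite in_setU in_set in_setC.
    case: (boolP (x \in near A)) => [//|xA] /=.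
    by have /andP[x0 xw] := pos2_lt Aw xA; lia.
  move=> j j2; apply: (level_small_col hP cA Aw) => i _; apply: nb; lia.
(* This [m] is the least one allowed by [tail_col], whose condition becomes [2 * (p - m) <= k]; the
   bound on [k] gives [3 <= m]. *)
- move=> k k5 wk; apply: chromatic_le; set m := p - k %/ 2.
  have mp : p = m + k %/ 2 by lia.
  have cover := graph_cover cA Aw m.
  have tail : col (near A :|: [set x | (x \notin near A) && (m <= pos2 A x)])
      (clique_number G + (p - 1)) by apply: (tail_col hP hK cA Aw); lia.
  (* The product is concave in [j], and at both ends, 5 and [m], it is at least [2 * p + 1 + k], the
     value of [clique_number G + (p - 1)]. *)
  have lvl j : 5 <= j < m.+1 -> col (level A j) ((j - 1) * (p + 3 - j)).
    move=> /andP[j5 jm]; apply: (level_col hP hK cA Aw); [lia|lia|].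
    by rewrite wk mp; nia.
  have low n : p + 1 + 2 * p <= n -> p + 1 + (clique_number G + (p - 1)) <= n ->
    col (level A 2 :|: level A 3) n by apply: (low_levels_col hP hK cA Aw).
  have fibres a b : (forall j, a <= j < b -> col (level A j) ((j - 1) * (p + 3 - j))) ->
      col [set x in ~: near A | a <= (pos2 A x).+1 < b]
        (\sum_(a <= j < b) (j - 1) * (p + 3 - j)).
    by apply: col_fibres.
  (* One [p - 1] goes to the tail. The other six, with the summand [3 * (p - 1)] of [j = 4] when
     [4 <= m], pay for the levels up to 4. *)
  have -> : clique_number G + 7 * (p - 1) = clique_number G + (p - 1) + 6 * (p - 1) by lia.
  rewrite -addnA; apply: colS cover _; apply: colU tail _.
  have [m4|m4] := leqP 4 m.
    rewrite addn1 big_ltn; last by lia.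
    have c4 : col (level A 4) (maxn ((4 - 1) * (p + 3 - 4)) (clique_number G + (p - 1))).
      apply: (level_col hP hK cA Aw); rewrite ?leq_maxl ?leq_maxr //; lia.
    pose n := maxn (p + 1 + 2 * p) (p + 1 + (clique_number G + (p - 1))).
    have c23 : col (level A 2 :|: level A 3) n.
      by apply: low; [exact: leq_maxl|exact: leq_maxr].
    apply: (colS _ (colW _ (colU (colU c23 c4) (fibres _ _ lvl)))); last first.
      by rewrite [leqRHS]addnA leq_add2r /n; lia.
    apply/subsetP => x; rewrite in_set in_setC !in_setU !in_level in_set in_setC.
    by case: (x \in near A) => //= xj; lia.
  have m3 : m = 3 by lia.
  rewrite m3 big_geq // addn0; apply: colS (low _ _ _); [|lia|lia].
  apply/subsetP => x; rewrite in_setU in_set in_setC !in_level.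
  by move=> /andP[-> xj] /=; lia.
- move=> wp; apply: chromatic_le.
  (* For [m = 2] the condition of [tail_col] is exactly [3 * p - 2 <= clique_number G]; only cell
     (0, 1) is left, and as a cluster it costs [3 * p - 2] more. *)
  have tail : col (near A :|: [set x | (x \notin near A) && (2 <= pos2 A x)])
      (clique_number G + (p - 1)) by apply: (tail_col hP hK cA Aw); lia.
  have cell01 : col (cell A 0 1) (clique_number G).
    apply: cluster_col; first exact: cell_cluster.
    by move=> Q _; apply: clique_leq.
  apply: (colW _ (colS _ (colU tail cell01))); first by lia.
  apply: subset_trans (graph_cover cA Aw 2) _; apply: setUS.
  apply/subsetP => x; rewrite in_set in_setC => /andP[xA xj].
  have [a [b [_ _ _ _]]] := posP xA; rewrite in_set xA.
  have -> : pos2 A x = 1 by lia.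
  by case: pos1.
- move=> wp; apply: chromatic_le.
  (* All far vertices form the tail. Taking [m = 0] requires [3 * p - 1], whereas [m = 1] would
     require [3 * p]. *)
  apply: colS (tail_col hP hK cA Aw (m := 0) _ _); [|lia|lia].
  by apply/subsetP => x _; rewrite in_setU in_set /= andbT orbN.
Qed.
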